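(* Let $M \ge 2$ be an integer, let $\mathcal A \subset \{0, \dots, M-1\}$ be nonempty, and let $\chi \in \mathcal G^s_{c}((0,1))$ for some $s > 1$, with values in $[0,1]$. Let $B_N$ be the associated quantum open baker's map, $\mathcal N_N(\nu)$ its eigenvalue counting function, and $\delta = \frac{\log|\mathcal A|}{\log M}$. Then there is a constant $C$ depending only on $\chi$ and $M$ such that for all $\nu \ge 1$ and all sufficiently large $N = KM$ with $K \in \mathbb N$, $$\mathcal N_N(\nu) \le C N^\delta \nu^{(1-\delta)s}.$$
   Context: For $N \in \mathbb N$, $\mathbb Z_N = \mathbb Z/N\mathbb Z \simeq \{0,\dots,N-1\}$ and $\ell^2_N = \ell^2(\mathbb Z_N)$. The unitary discrete Fourier transform is $\mathcal F_N u(j) = N^{-1/2}\sum_{\ell=0}^{N-1} e^{-2\pi i j\ell/N} u(\ell)$. Let $N = KM$ with $K \in \mathbb N$. For $a \in \{0,\dots,M-1\}$ define $\Pi_a : \ell^2_N \to \ell^2_K$ by $\Pi_a u(j) = u(j + aK)$, $j \in \{0,\dots,K-1\}$. The quantum open baker's map is $$B_N = \sum_{a \in \mathcal A} \mathcal F_N^* \Pi_a^* \chi_K \mathcal F_K \chi_K \Pi_a,$$ where $\chi_K$ is multiplication by $j \mapsto \chi(j/K)$ on $\ell^2_K$. For $\nu \ge 0$, $\mathcal N_N(\nu)$ is the number of eigenvalues $\lambda$ of $B_N$ with $|\lambda| \ge M^{-\nu}$, counted with multiplicity. For $s>1$, $\mathcal G^s_c((0,1))$ is the set of $f \in C_c^\infty(\mathbb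 R)$ with $\operatorname{supp} f \subset (0,1)$ that are $s$-Gevrey: for every compact $K' \subset \mathbb R$ there is $C_{K',f}$ with $\sup_{x \in K'}|\partial^\alpha f(x)| \le C_{K',f}^{\alpha+1}(\alpha!)^s$ for all integers $\alpha \ge 0$. *)

(* Defs.v *)
From mathcomp Require Import all_boot all_order all_algebra.
From mathcomp Require Import all_classical all_reals all_analysis.
From mathcomp.real_closed Require Import complex.
Set Implicit Arguments. Unset Strict Implicit. Unset Printing Implicit Defensive.
Import Order.TTheory GRing.Theory Num.Theory.
Import numFieldNormedType.Exports.
Local Open Scope classical_set_scope.
Local Open Scope ring_scope.
Local Open Scope complex_scope.

Section Baker.
Variable R : realType.

Definition expi (t : R) : R[i] := (cos t +i* sin t).

Definition dft (n : nat) : 'M[R[i]]_n :=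
  \matrix_(p, q)
    (((Num.sqrt (n%:R : R))^-1)%:C * expi (- (2 * pi * (p%:R * q%:R) / n%:R))).

Definition adjmx (m n : nat) (A : 'M[R[i]]_(m, n)) : 'M[R[i]]_(n, m) :=
  \matrix_(p, q) conjc (A q p).

Definition proj_a (K M : nat) (a : nat) : 'M[R[i]]_(K, K * M) :=
  \matrix_(j, m) (((m : nat) == j + a * K)%N)%:R.

Definition cutoff_mx (K : nat) (chi : R -> R) : 'M[R[i]]_K :=
  diag_mx (\row_(j < K) (chi (j%:R / K%:R))%:C).

Definition baker (M K : nat) (A : {set 'I_M}) (chi : R -> R) : 'M[R[i]]_(K * M) :=
  \sum_(a in A)
    adjmx (dft (K * M)) *m adjmx (proj_a K M a) *m cutoff_mx K chi
      *m dft K *m cutoff_mx K chi *m proj_a K M a.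

(* the eigenvalues of a complex square matrix, listed with (algebraic)
   multiplicity: the roots of its characteristic polynomial *)
Definition eigenvalues (n : nat) (B : 'M[R[i]]_n) : seq R[i] :=
  projT1 (closed_field_poly_normal (char_poly B)).

Definition eig_count (n : nat) (B : 'M[R[i]]_n) (t : R) : nat :=
  count (fun z : R[i] => t%:C <= `|z|) (eigenvalues B).

Definition counting_fn (M K : nat) (A : {set 'I_M}) (chi : R -> R) (nu : R) : nat :=
  eig_count (baker K A chi) (powR (M%:R : R) (- nu)).

Definition gevrey_c01 (s : R) (f : R -> R) : Prop :=
  (forall (n : nat) (x : R), derivable (derive1n n f) x 1) /\
  compact (closure [set x | f x != 0]) /\
  closure [set x | f x != 0] `<=` (`]0, 1[%classic) /\
  (forall K' : set R, compact K' ->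
     exists C : R, forall (alpha : nat) (x : R), K' x ->
       `|derive1n alpha f x| <= C ^+ alpha.+1 * powR ((factorial alpha)%:R) s).

End Baker.

(* Main.v *)
Require Import Defs.
From mathcomp Require Import all_boot all_order all_algebra.
From mathcomp Require Import all_classical all_reals all_analysis.
From mathcomp.real_closed Require Import complex.
From mathcomp Require Import perm ring lra.
Import Order.TTheory GRing.Theory Num.Theory.
Set Implicit Arguments. Unset Strict Implicit. Unset Printing Implicit Defensive.
Import numFieldNormedType.Exports.
Import Normc.
Local Open Scope ring_scope.
Local Open Scope complex_scope.

(** If [V] spans an invariant subspace of [B] carrying [m] prescribed
    eigenvalues, expanding a maximal weighted minor of [V *m B] shows that the
    product of these eigenvalues is at most a product of [m] distinct weighted
    column sums [sum_j |B j l| w j / w l], for any positive weight [w].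

    Summation by parts and the Gevrey bounds make the kernel of the baker's map
    decay off the graph of the expanding map [x |-> M x - a]: it is at most
    [(n + 1) C^(n+1) n!^s / t^n] at distance [t], for every [n].  Take
    [w = (W + d)^-p], where [d] is the distance (in units of [1 / N]) to a
    finite stage of the Cantor set with digits in [A], [p] is of order [nu] and
    [W] of order [p^s].  The expanding map multiplies [d] by at least [M], so a
    column at distance [d > W] gains a factor exponentially small in [p], while
    the Gevrey decay absorbs the growth of the weight along the tails.  Hence the
    number of eigenvalues is at most a constant times the number of positions
    with [d <= W].  The stage is chosen with intervals of length about [W], so
    there are at most a constant times [(N / W)^delta W] of them. *)

(** * Eigenvalues and weighted column sums *)

Lemma similar_char_poly (F : fieldType) n (P A B : 'M[F]_n) :
  P \in unitmx -> similar P A B -> char_poly A = char_poly B.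
Proof.
move=> uP /(similarP uP) PA.
have PX : map_mx polyC P *m char_poly_mx A = char_poly_mx B *m map_mx polyC P.
  by rewrite mulmxBr mulmxBl -!map_mxM PA scalar_mxC.
apply: (@mulfI _ (\det (map_mx polyC P))); last by rewrite -det_mulmx PX det_mulmx mulrC.
by rewrite det_map_mx polyC_eq0 -unitfE -unitmxE.
Qed.

Lemma char_poly_lblock (R : comNzRingType) n1 n2 (A : 'M[R]_n1) (C : 'M[R]_(n2, n1))
    (D : 'M[R]_n2) :
  char_poly (block_mx A 0 C D) = char_poly A * char_poly D.
Proof.
rewrite /char_poly /char_poly_mx scalar_mx_block map_block_mx opp_block_mx.
by rewrite add_block_mx map_mx0 subr0 det_lblock.
Qed.

Lemma char_poly_scalar1 (R : comNzRingType) (z : R) :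
  char_poly (z%:M : 'M[R]_1) = 'X - z%:P.
Proof. by rewrite /char_poly /char_poly_mx map_scalar_mx -raddfB det_scalar1. Qed.

Lemma eigenvalue_similar_lblock (F : fieldType) n (B : 'M[F]_(1 + n)) z :
  eigenvalue B z ->
  exists2 P, P \in unitmx & exists C D, similar P B (block_mx z%:M 0 C D).
Proof.
case/eigenvalueP=> v vB v0; pose P : 'M[F]_(1 + n) := row_ebase v.
have uP : P \in unitmx by exact: row_ebase_unit.
pose e : 'M[F]_(1, 1 + n) := row_mx 1%:M 0 *m P.
have v_e : v = col_ebase v *m e.
  rewrite /e -{1}(mulmx_ebase v) -mulmxA; congr (_ *m (_ *m _)).
  have -> : \rank v = 1 by apply/eqP; rewrite rank_rV v0.
  by rewrite (@pid_mx_row F n 1).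
have eB : e *m B = z *: e.
  have -> : e = invmx (col_ebase v) *m v by rewrite {2}v_e mulKmx // col_ebase_unit.
  by rewrite -mulmxA vB -scalemxAr.
pose B' := conjmx P B.
have uB' : usubmx B' = row_mx z%:M 0.
  have -> : usubmx B' = row_mx 1%:M 0 *m B'.
    by rewrite -{2}[B']vsubmxK mul_row_col mul1mx mul0mx addr0.
  rewrite /B' conjumx // !mulmxA -/e eB -scalemxAl mulmxK //.
  by rewrite scale_row_mx scalemx1 scaler0.
exists P => //; exists (dlsubmx B'), (drsubmx B'); apply/eqP.
by rewrite -/B' -[LHS]submxK /ulsubmx /ursubmx uB' row_mxKl row_mxKr.
Qed.

Lemma char_poly_prod_stablemx (F : fieldType) (s : seq F) n (B : 'M[F]_n)
    (q : {poly F}) :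
  char_poly B = (\prod_(z <- s) ('X - z%:P)) * q ->
  exists V : 'M[F]_(size s, n),
    [/\ row_free V, stablemx V B & \det (conjmx V B) = \prod_(z <- s) z].
Proof.
elim: s n B => [|z s IH] n B.
  move=> _; exists 0; rewrite /row_free mxrank0 eqxx det_mx00 big_nil.
  by split; rewrite ?stable0mx.
rewrite big_cons -mulrA => charB.
have : eigenvalue B z by rewrite eigenvalue_root_char charB rootM root_XsubC eqxx.
case: n B charB => [|n] B charB; first by case/eigenvalueP=> v; rewrite [v]thinmx0 eqxx.
change (n.+1) with (1 + n)%N in (type of B).
case/eigenvalue_similar_lblock=> P uP [C [D BP]].
have charD : char_poly D = \prod_(x <- s) ('X - x%:P) * q.
  have := similar_char_poly uP BP; rewrite char_poly_lblock char_poly_scalar1 charB.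
  by move/mulfI => -> //; rewrite polyXsubC_eq0.
have [V [freeV stabV detV]] := IH _ _ charD.
pose Vz : 'M[F]_(1 + size s, 1 + n) := block_mx 1%:M 0 0 V.
pose T : 'M[F]_(1 + size s) := block_mx z%:M 0 (V *m C) (conjmx V D).
have VzPB : Vz *m P *m B = T *m (Vz *m P).
  rewrite -mulmxA (similarP uP BP) !mulmxA /Vz /T !mulmx_block; congr (_ *m P).
  by rewrite !mul0mx !mulmx0 !mulmx1 !mul1mx !addr0 !add0r mulmxKpV.
have detT : \det T = z * \prod_(x <- s) x by rewrite det_lblock det_scalar1 detV.
have freeVzP : row_free (Vz *m P).
  rewrite /row_free mxrankMfree ?row_free_unit // rank_diag_block_mx mxrank1.
  by rewrite (eqP freeV).
exists (Vz *m P); split; first exact: freeVzP.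
  by rewrite VzPB submxMl.
by rewrite (eqP (similarW freeVzP VzPB)) big_cons; exact: detT.
Qed.

Lemma det_mulmx_colsub (R : comPzRingType) n m (V : 'M[R]_(n, m)) (C : 'M[R]_(m, n)) :
  \det (V *m C) =
    \sum_(f : {ffun 'I_n -> 'I_m}) (\prod_i C (f i) i) * \det (colsub f V).
Proof.
rewrite -[LHS]det_tr {1}/determinant.
transitivity (\sum_(f : {ffun 'I_n -> 'I_m}) \sum_(t : {perm 'I_n})
   (-1) ^+ t * \prod_i (V (t i) (f i) * C (f i) i)).
  rewrite exchange_big /=; apply: eq_bigr => t _.
  rewrite -big_distrr /=; congr (_ * _).
  rewrite -(bigA_distr_bigA (fun i j => V (t i) j * C j i)).
  by apply: eq_bigr => i _; rewrite !mxE.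
apply: eq_bigr => f _; rewrite -det_tr /determinant big_distrr /=.
apply: eq_bigr => t _; rewrite big_split /= mulrCA mulrA mulrC; congr (_ * _).
by rewrite mulrC; congr (_ * _); apply: eq_bigr => i _; rewrite !mxE.
Qed.

Lemma row_free_det_colsub_neq0 (F : fieldType) n m (V : 'M[F]_(n, m)) :
  row_free V -> exists f : {ffun 'I_n -> 'I_m}, \det (colsub f V) != 0.
Proof.
move=> freeV; have fullVT : row_full V^T by rewrite /row_full mxrank_tr.
exists [ffun i => fullrankfun fullVT i]; rewrite -det_tr -unitfE.
have -> : (colsub [ffun i => fullrankfun fullVT i] V)^T =
    rowsub (fullrankfun fullVT) V^T by apply/matrixP => i j; rewrite !mxE ffunE.
by rewrite -unitmxE -row_full_unit fullrowsub_full.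
Qed.

Lemma det_colsub_neq0_inj (R : comNzRingType) n m (V : 'M[R]_(n, m)) (f : 'I_n -> 'I_m) :
  \det (colsub f V) != 0 -> injective f.
Proof.
move=> detV i k fik; apply/eqP; apply: contraNT detV => nik.
apply/eqP; rewrite -det_tr; apply: (determinant_alternate nik) => j.
by rewrite !mxE fik.
Qed.

Lemma exists_max_weighted_minor (F : numFieldType) n m (V : 'M[F]_(n, m))
    (w : 'I_m -> F) :
  (forall l, 0 < w l) -> row_free V ->
  exists2 J : {ffun 'I_n -> 'I_m}, \det (colsub J V) != 0 &
    forall f : {ffun 'I_n -> 'I_m}, `|\det (colsub f V)| <=
      `|\det (colsub J V)| / \prod_i w (J i) * \prod_i w (f i).
Proof.
move=> w0 freeV; have [f0 detf0] := row_free_det_colsub_neq0 freeV.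
pose minor (f : {ffun 'I_n -> 'I_m}) : F := `|\det (colsub f V)| / \prod_i w (f i).
have prodw0 (f : {ffun 'I_n -> 'I_m}) : 0 < \prod_i w (f i) by apply: prodr_gt0.
have minor0 f : 0 <= minor f by rewrite divr_ge0 // ltW.
pose J := [arg max_(f > f0) minor f]%O.
have maxJ f : minor f <= minor J.
  by rewrite /J; case: real_arg_maxP => // [i _|i _ /(_ f)]; [rewrite ger0_real|exact].
exists J => [|f]; last by rewrite -ler_pdivrMr //; exact: maxJ.
have : 0 < minor J by apply: lt_le_trans (maxJ f0); rewrite divr_gt0 // normr_gt0.
by apply: contraTneq => detJ; rewrite /minor detJ normr0 mul0r ltxx.
Qed.

Definition weighted_colsum (F : numFieldType) n (w : 'I_n -> F) (B : 'M[F]_n)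
    (l : 'I_n) : F :=
  (\sum_j B j l * w j) / w l.

(* [J] indexes the minor of [V] that is maximal relative to the weight [w];
   expanding the minor of [V *m B] along the same columns bounds the determinant. *)
Lemma norm_det_conjmx_le (F : numFieldType) n m (V : 'M[F]_(n, m)) (B : 'M[F]_m)
    (w : 'I_m -> F) :
  (forall l, 0 < w l) -> row_free V -> stablemx V B ->
  exists2 J : 'I_n -> 'I_m, injective J &
    `|\det (conjmx V B)| <= \prod_i weighted_colsum w (map_mx Num.norm B) (J i).
Proof.
move=> w0 freeV stabV; have [J detJ maxJ] := exists_max_weighted_minor w0 freeV.
exists J; first exact: det_colsub_neq0_inj detJ.
have expand : \det (conjmx V B) * \det (colsub J V) =
    \sum_(f : {ffun 'I_n -> 'I_m}) (\prod_i B (f i) (J i)) * \det (colsub f V).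
  rewrite -det_mulmx mulmx_colsub mulmxKpV // -mulmx_colsub det_mulmx_colsub.
  by under eq_bigr do under eq_bigr do rewrite mxE.
set wJ := \prod_i w (J i) in maxJ.
have detJ0 : 0 < `|\det (colsub J V)| by rewrite normr_gt0.
rewrite /weighted_colsum big_split /= prodfV -/wJ -(ler_pM2r detJ0) -normrM expand.
rewrite -mulrA [wJ^-1 * _]mulrC bigA_distr_bigA /= mulr_suml.
apply: le_trans (ler_norm_sum _ _ _) (ler_sum _ _) => f _.
rewrite big_split normrM normr_prod /= -mulrA.
under [X in _ <= X * _]eq_bigr do rewrite mxE.
by rewrite ler_wpM2l ?prodr_ge0 // mulrC maxJ.
Qed.

Lemma normr_normc (R : rcfType) (z : R[i]) : `|z| = (normc z)%:C.
Proof. by case: z. Qed.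

Lemma normc_ge0 (R : rcfType) (z : R[i]) : 0 <= normc z.
Proof. by case: z => a b; exact: sqrtr_ge0. Qed.

Lemma normc_real (R : rcfType) (x : R) : normc x%:C = `|x|.
Proof. by rewrite /= expr0n addr0 sqrtr_sqr. Qed.

Definition absmx (R : rcfType) n (B : 'M[R[i]]_n) : 'M[R]_n := map_mx (@normc R) B.

Lemma weighted_colsum_absmx (R : rcfType) n (w : 'I_n -> R) (B : 'M[R[i]]_n) l :
  (weighted_colsum w (absmx B) l)%:C =
    weighted_colsum (fun j => (w j)%:C) (map_mx Num.norm B) l.
Proof.
rewrite /weighted_colsum rmorphM fmorphV rmorph_sum; congr (_ / _).
by apply: eq_bigr => j _; rewrite !mxE normr_normc rmorphM.
Qed.

Lemma char_poly_eigenvalues (R : realType) n (B : 'M[R[i]]_n) :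
  char_poly B = \prod_(z <- eigenvalues B) ('X - z%:P).
Proof.
rewrite /eigenvalues; case: closed_field_poly_normal => r /= {1}->.
by rewrite (eqP (char_poly_monic B)) scale1r.
Qed.

Section EigenvalueCount.
Variables (R : realType) (n : nat) (B : 'M[R[i]]_n) (t : R) (w : 'I_n -> R).
Hypothesis w_gt0 : forall l, 0 < w l.

Lemma expr_eig_count_le : 0 <= t ->
  exists2 J : 'I_(eig_count B t) -> 'I_n, injective J &
    t ^+ eig_count B t <= \prod_i weighted_colsum w (absmx B) (J i).
Proof.
move=> t0; pose large (z : R[i]) := t%:C <= `|z|.
have charB : char_poly B =
    \prod_(z <- seq.filter large (eigenvalues B)) ('X - z%:P) *
    \prod_(z <- eigenvalues B | ~~ large z) ('X - z%:P).
  by rewrite char_poly_eigenvalues big_filter (bigID large) /=.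
have [V [freeV stabV detV]] := char_poly_prod_stablemx charB.
have wC_gt0 l : 0 < (w l)%:C by rewrite ltcR.
have [J injJ detJ] := norm_det_conjmx_le wC_gt0 freeV stabV.
have <- : size (seq.filter large (eigenvalues B)) = eig_count B t.
  by rewrite size_filter.
exists J => //; rewrite -lecR; apply: le_trans (le_trans detJ _).
  rewrite detV rmorphXn /= normr_prod.
  elim: (eigenvalues B) => [|z r IH] /=; first by rewrite big_nil expr0.
  by case: ifP => // zt; rewrite big_cons exprS ler_pM ?exprn_ge0 ?ler0c.
by rewrite rmorph_prod; under [leRHS]eq_bigr do rewrite /= weighted_colsum_absmx.
Qed.

Lemma eig_count_le_card (X : {set 'I_n}) (q : R) k :
  0 < t -> 1 < q ->
  (forall l, weighted_colsum w (absmx B) l <= t * q ^+ k) ->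
  (forall l, l \notin X -> weighted_colsum w (absmx B) l <= t / q) ->
  (eig_count B t <= k.+1 * #|X|)%N.
Proof.
move=> t0 q1 bound boundX; have q0 : 0 < q by exact: lt_trans q1.
have [J injJ] := expr_eig_count_le (ltW t0); set m := eig_count B t => prodJ.
pose JX := (J @^-1: X)%SET; have JX_X : (#|JX| <= #|X|)%N.
  rewrite -(card_imset _ injJ); apply/subset_leq_card/fintype.subsetP => l.
  by case/imsetP=> i; rewrite inE => iX ->.
have JXm : (#|JX| <= m)%N by rewrite (leq_trans (max_card _)) // card_ord.
have powers : t ^+ m <= (t * q ^+ k) ^+ #|JX| * (t / q) ^+ (m - #|JX|).
  apply: le_trans prodJ _.
  apply: (@le_trans _ _ (\prod_i (if i \in JX then t * q ^+ k else t / q))).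
    apply: ler_prod => i _; apply/andP; split; last first.
      by rewrite inE; case: ifPn => [_|iX]; [exact: bound|exact: boundX].
    rewrite divr_ge0 ?(ltW (w_gt0 _)) // sumr_ge0 // => l _.
    by rewrite mxE mulr_ge0 ?normc_ge0 ?(ltW (w_gt0 _)).
  rewrite big_if /= !prodr_const.
  have -> // : #|[pred i | i \notin JX]| = (m - #|JX|)%N.
  by apply/eqP; rewrite -(eqn_add2l #|JX|) cardC card_ord subnKC.
suff : (m - #|JX| <= k * #|JX|)%N.
  by rewrite leq_subLR -mulSn => /leq_trans; apply; rewrite leq_mul2l JX_X orbT.
rewrite -(ler_eXn2l q1) exprM -(ler_pM2l (exprn_gt0 m t0)).
rewrite -ler_pdivlMr ?exprn_gt0 // (le_trans powers) // exprMn expr_div_n.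
have -> : t ^+ m = t ^+ #|JX| * t ^+ (m - #|JX|) by rewrite -exprD subnKC.
by rewrite mulrACA mulrA.
Qed.

End EigenvalueCount.

(** * Exponential sums of smooth functions *)

Section FiniteDifferences.
Variable R : realType.
Implicit Types (f : R -> R) (h x b : R).

Definition smooth f := forall n x, derivable (derive1n n f) x 1.

Definition bdiff h f : R -> R := fun x => f x - f (x - h).

Lemma is_derive_bdiff h f (df : R -> R) x :
  (forall y : R, is_derive y 1 f (df y)) -> is_derive x 1 (bdiff h f) (bdiff h df x).
Proof.
move=> fdf; have shift : is_derive x 1 (fun y : R => y - h) 1.
  by apply: is_derive_eq; rewrite subr0.
have : is_derive x 1 (f \o (fun y : R => y - h)) (df (x - h)).
  by apply: is_derive_eq; rewrite mulr1.
exact: is_deriveB.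
Qed.

Lemma smooth_is_derive f n x :
  smooth f -> is_derive x 1 (derive1n n f) (derive1n n.+1 f x).
Proof. by move=> sf; rewrite derive1nS derive1E; apply: DeriveDef. Qed.

Lemma derive1n_bdiff h f n :
  smooth f -> derive1n n (bdiff h f) = bdiff h (derive1n n f).
Proof.
move=> sf; elim: n => [//|n IH]; rewrite derive1nS IH; apply/funext => x.
rewrite derive1E; have dbdiff := is_derive_bdiff h x (fun y => smooth_is_derive n y sf).
exact: derive_val.
Qed.

Lemma smooth_bdiff h f : smooth f -> smooth (bdiff h f).
Proof.
move=> sf n x; rewrite derive1n_bdiff //.
by have [] := is_derive_bdiff h x (fun y => smooth_is_derive n y sf).
Qed.

Lemma norm_bdiff_le h f (df : R -> R) b x : 0 <= h ->
  (forall y : R, is_derive y 1 f (df y)) -> (forall y, `|df y| <= b) ->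
  `|bdiff h f x| <= h * b.
Proof.
move=> h0 fdf dfb; rewrite /bdiff.
have [||z _ ->] := @MVT_segment R f df (x - h) x.
- by rewrite gerBl.
- by apply: derivable_within_continuous => y _; case: (fdf y).
by rewrite subKr normrM mulrC (ger0_norm h0) ler_wpM2l.
Qed.

Lemma norm_iter_bdiff_le h f n b x : 0 <= h -> smooth f ->
  (forall y, `|derive1n n f y| <= b) -> `|iter n (bdiff h) f x| <= h ^+ n * b.
Proof.
move=> h0; elim: n f b x => [|n IH] f b x sf fb; first by rewrite mul1r; exact: fb.
rewrite iterSr exprSr -mulrA; apply: IH => [|y]; first exact: smooth_bdiff.
rewrite derive1n_bdiff //.
exact: norm_bdiff_le h0 (fun z => smooth_is_derive n z sf) fb.
Qed.

Lemma summation_by_parts (z : R[i]) h f L : 0 <= h ->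
  (forall x, x <= 0 -> f x = 0) -> (forall x, L%:R * h <= x -> f x = 0) ->
  (1 - z) * (\sum_(p < L) (f (p%:R * h))%:C * z ^+ p) =
  \sum_(p < L.+1) (bdiff h f (p%:R * h))%:C * z ^+ p.
Proof.
move=> h0 f_left f_right; rewrite mulrBl mul1r /bdiff.
under [RHS]eq_bigr do rewrite raddfB mulrBl.
rewrite sumrB big_ord_recr /= (f_right (L%:R * h)) // mul0r addr0; congr (_ - _).
rewrite big_ord_recl /= mul0r sub0r (f_left (- h)) ?oppr_le0 // mul0r add0r.
rewrite mulr_sumr; apply: eq_bigr => i _; rewrite /bump /= exprS mulrCA.
by congr (_ * _); rewrite natrD mulrDl mul1r addrAC subrr add0r.
Qed.

Lemma iter_summation_by_parts (z : R[i]) h f L n : 0 <= h ->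
  (forall x, x <= 0 -> f x = 0) -> (forall x, L%:R * h <= x -> f x = 0) ->
  (1 - z) ^+ n * (\sum_(p < L) (f (p%:R * h))%:C * z ^+ p) =
  \sum_(p < L + n) (iter n (bdiff h) f (p%:R * h))%:C * z ^+ p.
Proof.
move=> h0; elim: n f L => [|n IH] f L f_left f_right; first by rewrite mul1r addn0.
rewrite exprSr -mulrA summation_by_parts // IH.
- by rewrite addSnnS; apply: eq_bigr => i _; rewrite iterSr.
- by move=> x x0; rewrite /bdiff !f_left ?subrr // subr_le0 (le_trans x0).
- move=> x; rewrite -natr1 mulrDl mul1r => hx; rewrite /bdiff !f_right ?subrr //.
    by rewrite lerBrDr.
  by apply: le_trans hx; rewrite lerDl.
Qed.

Lemma normc_power_sum_le (z : R[i]) h f L n b :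
  0 <= h -> normc z = 1 -> smooth f ->
  (forall x, x <= 0 -> f x = 0) -> (forall x, L%:R * h <= x -> f x = 0) ->
  (forall x, `|derive1n n f x| <= b) ->
  normc (1 - z) ^+ n * normc (\sum_(p < L) (f (p%:R * h))%:C * z ^+ p) <=
    (L + n)%:R * (h ^+ n * b).
Proof.
move=> h0 z1 sf f_left f_right fb; rewrite -lecR rmorphM rmorphXn /= -!normr_normc.
rewrite -normrX -normrM iter_summation_by_parts // (le_trans (ler_norm_sum _ _ _)) //.
have -> : ((L + n)%:R * (h ^+ n * b))%:C = \sum_(p < L + n) (h ^+ n * b)%:C.
  by rewrite sumr_const card_ord mulr_natl raddfMn.
apply: ler_sum => p _; rewrite normrM normrX !normr_normc z1 expr1n mulr1.
by rewrite normc_real lecR norm_iter_bdiff_le.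
Qed.

End FiniteDifferences.

Section ExponentialSums.
Variable R : realType.
Implicit Types (x y b c theta : R) (f : R -> R).

Lemma expiD x y : expi (x + y) = expi x * expi y.
Proof. by rewrite /expi cosD sinD; simpc; congr (_ +i* _); rewrite addrC. Qed.

Lemma expiX x n : expi (n%:R * x) = expi x ^+ n.
Proof.
elim: n => [|n IH]; first by rewrite mul0r /expi cos0 sin0.
by rewrite exprSr -IH -expiD -natr1 mulrDl mul1r.
Qed.

Lemma normc_expi x : normc (expi x) = 1.
Proof. by rewrite /= cos2Dsin2 sqrtr1. Qed.

Lemma normc_1Bexpi x : normc (1 - expi (2 * x)) = 2 * `|sin x|.
Proof.
have -> : 2 * `|sin x| = `|2 * sin x| by rewrite normrM ger0_norm.
rewrite -sqrtr_sqr mulr_natl mulr2n /expi cosD sinD /=; congr (Num.sqrt _).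
have cos2 : cos x ^+ 2 = 1 - sin x ^+ 2 by rewrite -(cos2Dsin2 x) addrK.
transitivity ((1 - cos x ^+ 2 + sin x ^+ 2) ^+ 2 + 4 * cos x ^+ 2 * sin x ^+ 2).
  by ring.
by rewrite cos2; ring.
Qed.

Lemma mulr_cos_le_sin x : 0 <= x <= pi -> x * cos x <= sin x.
Proof.
move=> /andP[x0 xpi]; pose g y : R := sin y - y * cos y.
have dg y : is_derive y 1 g (y * sin y).
  by apply: is_derive_eq; rewrite /GRing.scale /=; ring.
have [||z] := @MVT_segment R g (fun y => y * sin y) 0 x => //.
  by apply: derivable_within_continuous => y _; case: (dg y).
rewrite in_itv /= => /andP[z0 zx]; rewrite {1 2}/g sin0 mul0r !subr0 => gE.
by rewrite -subr_ge0 gE !mulr_ge0 // sin_ge0_pi // z0 (le_trans zx).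
Qed.

Lemma ler_cos : {in `[0, pi] &, {homo @cos R : x y /~ x <= y}}.
Proof.
by move=> x y x0 y0; rewrite le_eqVlt => /predU1P[->//|yx]; rewrite ltW // ltr_cos.
Qed.

Lemma cos_half_sqr_mul_le_sin b y :
  0 <= y <= b -> b <= pi -> cos (b / 2) ^+ 2 * y <= sin y.
Proof.
move=> /andP[y0 yb] bpi.
have cosb : 0 <= cos (b / 2) by rewrite cos_ge0_pihalf //; lra.
have cosy : cos (b / 2) <= cos (y / 2) by apply: ler_cos; rewrite ?in_itv /=; lra.
have -> : sin y = 2 * cos (y / 2) * sin (y / 2).
  by rewrite -{1}[y](@divfK _ 2) // mulr_natr sin_mulr2n -mulr_natl; ring.
have /mulr_cos_le_sin siny : 0 <= y / 2 <= pi by lra.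
have cosy0 : 0 <= 2 * cos (y / 2) by lra.
apply: le_trans (ler_wpM2l cosy0 siny).
have -> : 2 * cos (y / 2) * (y / 2 * cos (y / 2)) = cos (y / 2) ^+ 2 * y by field.
by rewrite ler_wpM2r // ler_sqr ?nnegrE ?(le_trans cosb).
Qed.

Lemma cos_half_sqr_mul_le_norm_sin b y :
  `|y| <= b -> b <= pi -> cos (b / 2) ^+ 2 * `|y| <= `|sin y|.
Proof.
move=> yb bpi; have sin_le u : 0 <= u <= b -> cos (b / 2) ^+ 2 * u <= `|sin u|.
  by move=> ub; apply: le_trans (ler_norm _); exact: cos_half_sqr_mul_le_sin.
have [y0|y0] := leP 0 y.
  by rewrite (ger0_norm y0) sin_le // y0 (le_trans (ler_norm _)).
by rewrite (ltr0_norm y0) -normrN -sinN sin_le // oppr_ge0 (ltW y0) -(ltr0_norm y0).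
Qed.

Definition expsum K f theta : R[i] :=
  \sum_(p < K) (f (p%:R / K%:R))%:C * expi (2 * (pi * theta)) ^+ p.

Definition expsum_rate c : R := 2 * pi * cos (pi * (1 - c) / 2) ^+ 2.

Lemma expsum_rate_gt0 c : 0 < c < 1 -> 0 < expsum_rate c.
Proof.
move=> /andP[c0 c1]; have pi0 := @pi_gt0 R.
have cos0 : 0 < cos (pi * (1 - c) / 2).
  by rewrite cos_gt0_pihalf //; apply/andP; split; nra.
by rewrite /expsum_rate !mulr_gt0.
Qed.

Lemma expsum_rate_le c theta : 0 <= c -> `|theta| <= 1 - c ->
  expsum_rate c * `|theta| <= normc (1 - expi (2 * (pi * theta))).
Proof.
move=> c0 thetac; have pi0 := @pi_gt0 R.
have := @cos_half_sqr_mul_le_norm_sin (pi * (1 - c)) (pi * theta).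
rewrite normrM gtr0_norm // ler_pM2l // ger_pMr // gerBl => /(_ thetac c0).
by rewrite normc_1Bexpi /expsum_rate; move: (cos _ ^+ 2) => k; lra.
Qed.

Lemma normc_expsum_le K f n b c theta : (0 < K)%N -> smooth f -> 0 < c ->
  (forall x, f x != 0 -> c <= x <= 1 - c) -> (forall x, `|derive1n n f x| <= b) ->
  `|theta| <= 1 - c ->
  (expsum_rate c * (K%:R * `|theta|)) ^+ n * normc (expsum K f theta) <= (K + n)%:R * b.
Proof.
move=> K_gt0 sf c0 supp fb thetac; have KR_gt0 : 0 < K%:R :> R by rewrite ltr0n.
have off_support x : ~~ (c <= x <= 1 - c) -> f x = 0.
  by move=> xc; apply/eqP; apply: contraNT xc => /supp.
have sum_le : normc (1 - expi (2 * (pi * theta))) ^+ n * normc (expsum K f theta) <=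
    (K + n)%:R * (K%:R^-1 ^+ n * b).
  apply: normc_power_sum_le (normc_expi _) sf _ _ fb => [|x x0|x].
  - by rewrite invr_ge0 ltW.
  - by apply: off_support; lra.
  - by rewrite divff ?gt_eqF // => x1; apply: off_support; lra.
have rate_le := expsum_rate_le (ltW c0) thetac.
rewrite mulrCA exprMn -mulrA mulrC -ler_pdivlMr ?exprn_gt0 //.
rewrite -[leRHS]mulrA [b / _]mulrC -exprVn; apply: le_trans sum_le.
rewrite ler_wpM2r ?normc_ge0 // lerXn2r ?nnegrE ?normc_ge0 //.
by rewrite mulr_ge0 // /expsum_rate mulr_ge0 ?sqr_ge0 // mulr_ge0 ?pi_ge0.
Qed.

End ExponentialSums.

Section Gevrey.
Variable R : realType.
Local Open Scope classical_set_scope.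

Lemma closed_dist_gt0 (S : set R) (a : R) : closed S -> ~ S a ->
  exists2 e, 0 < e & forall x, S x -> e <= `|a - x|.
Proof.
move=> clS Sa; have : nbhs a (~` S).
  by apply: open_nbhs_nbhs; split; first exact/closed_openC.
move=> /nbhs_ballP[e /= e0 ball_S]; exists e => // x Sx.
by rewrite leNgt; apply/negP => /ball_S.
Qed.

Lemma closed_sub_itvoo (S : set R) (a b : R) : closed S -> S `<=` `]a, b[ ->
  exists2 c, 0 < c & S `<=` `[a + c, b - c].
Proof.
move=> clS Sab; have itv x : S x -> a < x < b by move=> /Sab; rewrite /= in_itv.
have [|e e0 ae] := closed_dist_gt0 (a := a) clS; first by move=> /itv; rewrite ltxx.
have [|d d0 bd] := closed_dist_gt0 (a := b) clS; first by move=> /itv; rewrite ltxx andbF.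
exists (Num.min e d); rewrite ?lt_min ?e0 // => x Sx; have /andP[ax xb] := itv x Sx.
have := bd x Sx; have := ae x Sx; rewrite distrC !gtr0_norm ?subr_gt0 // => aex bdx.
by rewrite /= in_itv /= lerBrDr -!lerBrDl !ge_min aex bdx orbT.
Qed.

Lemma derive1n_eq0_off_support (f : R -> R) n x :
  (~` closure [set y | f y != 0]) x -> derive1n n f x = 0.
Proof.
have open_off : open (~` closure [set y | f y != 0]).
  exact/closed_openC/closed_closure.
elim: n x => [|n IH] x off_x.
  by apply/eqP; apply: contra_notT off_x => fx; exact: subset_closure.
rewrite derive1nS derive1E.
have near0 : \near x, derive1n n f x = cst 0 x.
  have : nbhs x (~` closure [set y | f y != 0]) by exact: open_nbhs_nbhs.
  by apply: filterS => y /IH.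
by rewrite (near_eq_derive _ near0) derive_val.
Qed.

Variables (s : R) (f : R -> R).
Hypothesis gevrey_f : gevrey_c01 s f.

Lemma gevrey_c01_support :
  exists2 c : R, 0 < c < 1 & forall x, f x != 0 -> c <= x <= 1 - c.
Proof.
have [_ [_ [sub01 _]]] := gevrey_f.
have [c c0 sub_c] := closed_sub_itvoo (@closed_closure _ _) sub01.
exists (Num.min c (1 / 2)) => [|x fx].
  by rewrite lt_min c0 gt_min; apply/andP; split; [|apply/orP; right]; lra.
have /sub_c : closure [set y | f y != 0] x by exact: subset_closure.
have min_c : Num.min c (1 / 2) <= c by rewrite ge_min lexx.
by rewrite /= in_itv /= => /andP[cx xc]; apply/andP; split; lra.
Qed.

Lemma gevrey_c01_derive_bound : exists2 C : R, 1 <= C &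
  forall n x, `|derive1n n f x| <= C ^+ n.+1 * powR (n`!%:R) s.
Proof.
have [_ [compact_supp [_ /(_ _ compact_supp)[C boundC]]]] := gevrey_f.
exists (Num.max 1 `|C|) => [|n x]; first by rewrite le_max lexx.
have [supp_x|off_x] := pselect (closure [set y | f y != 0] x); last first.
  by rewrite derive1n_eq0_off_support // normr0 mulr_ge0 ?powR_ge0 ?exprn_ge0.
apply: le_trans (boundC n x supp_x) _; rewrite ler_wpM2r ?powR_ge0 //.
apply: le_trans (ler_norm _) _; rewrite normrX lerXn2r ?nnegrE //.
by rewrite le_max lexx orbT.
Qed.

End Gevrey.

Definition gevrey_decay (R : realType) (s C b t : R) : Prop :=
  forall n, b * t ^+ n <= n.+1%:R * C ^+ n.+1 * powR (n`!%:R) s.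

Lemma gevrey_decay_scale (R : realType) (s C b t u v D : R) :
  0 <= b -> 0 <= t -> 0 <= C -> 1 <= u -> 0 <= v <= D -> 1 <= D ->
  gevrey_decay s C b t -> gevrey_decay s (D * u * C) (v * b) (u * t).
Proof.
move=> b0 t0 C_ge0 u1 /andP[v0 vD] D1 decay n; have u0 : 0 <= u by lra.
have -> : v * b * (u * t) ^+ n = (v * u ^+ n) * (b * t ^+ n) by rewrite exprMn mulrACA.
rewrite exprMn [n.+1%:R * _]mulrCA -[leRHS]mulrA ler_pM ?mulr_ge0 ?exprn_ge0 //.
by rewrite exprMn ler_pM ?exprn_ge0 ?ler_weXn2l // (le_trans vD) // ler_eXnr.
Qed.

Lemma gevrey_c01_expsum_decay (R : realType) (s : R) (f : R -> R) :
  gevrey_c01 s f ->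
  exists c C : R, [/\ 1 <= C, forall x, f x != 0 -> c <= x <= 1 - c,
    forall x, `|f x| <= C &
    forall K theta, (0 < K)%N -> `|theta| <= 1 - c ->
      gevrey_decay s C (normc (expsum K f theta) / K%:R) (K%:R * `|theta|)].
Proof.
move=> gevrey_f; have smooth_f : smooth f by case: gevrey_f.
have [c c01 supp] := gevrey_c01_support gevrey_f.
have [C C_ge1 der] := gevrey_c01_derive_bound gevrey_f.
have r0 := expsum_rate_gt0 c01; set r := expsum_rate c in r0.
have C_ge0 : 0 <= C by exact: le_trans C_ge1.
have ri0 : 0 <= r^-1 by rewrite invr_ge0 ltW.
have r1 : 1 <= 1 + r^-1 by rewrite lerDl.
exists c, (C * (1 + r^-1)); split=> // [|x|K theta K_gt0 theta_c n].
- by rewrite mulr_ege1.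
- apply: (le_trans (der 0 x)); rewrite fact0 powR1 mulr1 expr1.
  by rewrite ler_peMr.
have KR_gt0 : 0 < K%:R :> R by rewrite ltr0n.
case/andP: c01 => c0 _.
have := normc_expsum_le K_gt0 smooth_f c0 supp (der n) theta_c.
rewrite -/r exprMn -[leLHS]mulrA -ler_pdivlMl ?exprn_gt0 // => sum_le.
rewrite mulrAC ler_pdivrMr // mulrC (le_trans sum_le) // (exprMn _ C) -exprVn.
set g := powR _ _; have g0 : 0 <= g by exact: powR_ge0.
have -> : n.+1%:R * (C ^+ n.+1 * (1 + r^-1) ^+ n.+1) * g * K%:R =
   (1 + r^-1) ^+ n.+1 * ((n.+1 * K)%:R * (C ^+ n.+1 * g)) by rewrite natrM; ring.
rewrite ler_pM ?mulr_ge0 ?exprn_ge0 //.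
  apply: le_trans (ler_weXn2l r1 (leqnSn n)).
  by rewrite lerXn2r ?nnegrE ?addr_ge0 // lerDr.
by rewrite ler_wpM2r ?mulr_ge0 ?exprn_ge0 // ler_nat mulSn leq_add2l leq_pmulr.
Qed.

(** * The kernel of the baker's map *)

Lemma conj_dft (R : realType) n (p q : 'I_n) : conjc (dft R n p q) =
  ((Num.sqrt (n%:R : R))^-1)%:C * expi (2 * pi * (p%:R * q%:R) / n%:R).
Proof.
rewrite mxE /expi cosN sinN; apply/eqP; rewrite eq_complex /=.
by rewrite !mul0r !subr0 !addr0 mulrN opprK !eqxx.
Qed.

Section BakerKernel.
Variables (R : realType) (K M : nat).
Hypotheses (K_gt0 : (0 < K)%N) (M_gt0 : (0 < M)%N).
Implicit Types (A : {set 'I_M}) (chi : R -> R) (j l : 'I_(K * M)) (a : 'I_M) (p : 'I_K).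

Lemma branch_subproof l : (l %/ K < M)%N.
Proof. by rewrite ltn_divLR // (mulnC M). Qed.

Definition branch l : 'I_M := Ordinal (branch_subproof l).

Definition offset l : 'I_K := Ordinal (ltn_pmod l K_gt0).

Lemma block_pos_subproof a p : (p + a * K < K * M)%N.
Proof.
by rewrite (@leq_trans (K + a * K)) // ?ltn_add2r // -mulSn mulnC leq_mul2l ltn_ord orbT.
Qed.

Definition block_pos a p : 'I_(K * M) := Ordinal (block_pos_subproof a p).

Lemma mulmx_proj_a m (X : 'M[R[i]]_(m, K)) (a : 'I_M) i l :
  (X *m proj_a R K M a) i l = (branch l == a)%:R * X i (offset l).
Proof.
rewrite !mxE (bigD1 (offset l)) //= big1 ?addr0 => [|q ql].
  rewrite !mxE /= mulrC -val_eqE /=; congr (_%:R * _); rewrite {1}(divn_eq l K) addnC.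
  by rewrite eqn_add2l eqn_pmul2r.
rewrite !mxE; case: eqP => lE; last by rewrite mulr0.
by case/eqP: ql; apply: val_inj => /=; rewrite lE addnC modnMDl modn_small.
Qed.

Lemma mulmx_adj_proj_a m (Y : 'M[R[i]]_(m, K * M)) (a : 'I_M) i p :
  (Y *m adjmx (proj_a R K M a)) i p = Y i (block_pos a p).
Proof.
rewrite !mxE (bigD1 (block_pos a p)) //= big1 ?addr0 => [|q ql].
  by rewrite !mxE /= eqxx conjc1 mulr1.
rewrite !mxE; case: eqP => qE; last by rewrite conjc0 mulr0.
by case/eqP: ql; apply: val_inj.
Qed.

Lemma bakerE A chi j l :
  baker K A chi j l = (branch l \in A)%:R *
    \sum_(p < K) conjc (dft R (K * M) (block_pos (branch l) p) j) *
      (chi (p%:R / K%:R))%:C * dft R K p (offset l) * (chi ((offset l)%:R / K%:R))%:C.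
Proof.
rewrite /baker summxE; under eq_bigr => a _ do rewrite mulmx_proj_a.
have [lA|lA] := boolP (branch l \in A); last first.
  rewrite mul0r big1 // => a aA; case: eqP => [la|]; last by rewrite mul0r.
  by rewrite la aA in lA.
rewrite (bigD1 (branch l)) //= eqxx !mul1r big1 ?addr0; last first.
  by move=> a /andP[_]; rewrite eq_sym => /negPf ->; rewrite mul0r.
rewrite /cutoff_mx mul_mx_diag !mxE mulr_suml; apply: eq_bigr => p _; congr (_ * _).
by rewrite mul_mx_diag [in LHS]mxE (mulmx_adj_proj_a _ (branch l)) !mxE.
Qed.

Definition graph_angle j l : R := j%:R / (K * M)%:R - (offset l)%:R / K%:R.

Lemma conj_dft_mul_dft j l p :
  conjc (dft R (K * M) (block_pos (branch l) p) j) * dft R K p (offset l) =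
  ((Num.sqrt (K * M)%:R * Num.sqrt K%:R)^-1)%:C *
    expi (2 * pi * (branch l)%:R * j%:R / M%:R) *
    expi (2 * (pi * graph_angle j l)) ^+ p.
Proof.
rewrite conj_dft mxE /= -expiX mulrACA -[X in X * _]rmorphM -invfM.
rewrite -[RHS]mulrA -!expiD; congr (_ * expi _).
rewrite /graph_angle !natrM natrD natrM; field.
by rewrite !pnatr_eq0 -!lt0n K_gt0 M_gt0.
Qed.

Lemma normc_baker A chi j l :
  normc (baker K A chi j l) = (branch l \in A)%:R *
    ((Num.sqrt (K * M)%:R * Num.sqrt K%:R)^-1 * `|chi ((offset l)%:R / K%:R)| *
     normc (expsum K chi (graph_angle j l))).
Proof.
rewrite bakerE.
pose k : R[i] := ((Num.sqrt (K * M)%:R * Num.sqrt K%:R)^-1)%:C *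
  expi (2 * pi * (branch l)%:R * j%:R / M%:R) * (chi ((offset l)%:R / K%:R))%:C.
rewrite (eq_bigr (fun p : 'I_K => k *
  ((chi (p%:R / K%:R))%:C * expi (2 * (pi * graph_angle j l)) ^+ p))) => [|p _].
  rewrite -mulr_sumr -/(expsum K chi _) !normcM !normc_real normc_expi mulr1.
  rewrite (ger0_norm (_ : 0 <= _^-1)) ?invr_ge0 ?mulr_ge0 ?sqrtr_ge0 //; congr (_ * _).
  by case: (_ \in _); rewrite ?normc1 ?normc0.
by rewrite [X in X * _]mulrAC conj_dft_mul_dft // /k; ring.
Qed.

Lemma normr_graph_angle j l :
  K%:R * `|graph_angle j l| = `|j%:R - (offset l * M)%:R| / M%:R.
Proof.
have [KR_gt0 MR_gt0] : 0 < K%:R :> R /\ 0 < M%:R :> R by rewrite !ltr0n.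
have -> : graph_angle j l = (j%:R - (offset l * M)%:R) / (K * M)%:R.
  by rewrite /graph_angle !natrM; field; rewrite !gt_eqF.
rewrite normrM normfV (natrM _ K M) (gtr0_norm (mulr_gt0 KR_gt0 MR_gt0)).
by field; rewrite !gt_eqF.
Qed.

Lemma normr_graph_angle_le (c : R) j l :
  c <= (offset l)%:R / K%:R <= 1 - c -> `|graph_angle j l| <= 1 - c.
Proof.
move=> /andP[lc lc'].
have NR_gt0 : 0 < (K * M)%:R :> R by rewrite ltr0n muln_gt0 K_gt0.
have j0 : 0 <= j%:R / (K * M)%:R :> R by rewrite divr_ge0 // ltW.
have j1 : j%:R / (K * M)%:R <= 1 :> R by rewrite ler_pdivrMr // mul1r ler_nat ltnW.
by rewrite ler_norml; apply/andP; split; rewrite /graph_angle; lra.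
Qed.

Lemma normc_baker_le A chi j l :
  normc (baker K A chi j l) <= `|chi ((offset l)%:R / K%:R)| *
    (normc (expsum K chi (graph_angle j l)) / K%:R).
Proof.
have KR_gt0 : 0 < K%:R :> R by rewrite ltr0n.
have sqrt_ge : K%:R <= Num.sqrt (K * M)%:R * Num.sqrt K%:R :> R.
  rewrite -sqrtrM // -[leLHS](gtr0_norm KR_gt0) -sqrtr_sqr ler_wsqrtr // expr2.
  by rewrite ler_wpM2r // ler_nat leq_pmulr.
have xS0 : 0 <= `|chi ((offset l)%:R / K%:R)| * normc (expsum K chi (graph_angle j l)).
  by rewrite mulr_ge0 ?normc_ge0.
rewrite normc_baker // -mulrA mulrA [leRHS]mulrA [leRHS]mulrC ler_wpM2r //.
rewrite -[leRHS]mul1r ler_pM ?invr_ge0 ?mulr_ge0 ?sqrtr_ge0 ?lern1 ?leq_b1 //.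
by rewrite lef_pV2 ?posrE // (lt_le_trans KR_gt0).
Qed.

End BakerKernel.

(* The expanding map sends the position [l] to [(l %% K) * M]. *)
Definition decays_off_graph (R : realType) (K M : nat) (s C : R)
    (B : 'M[R[i]]_(K * M)) : Prop :=
  forall j l, gevrey_decay s C (normc (B j l)) `|j%:R - (l %% K * M)%:R|.

Lemma baker_decays_off_graph (R : realType) (M : nat) (s : R) (chi : R -> R) :
  (0 < M)%N -> gevrey_c01 s chi ->
  exists2 C : R, 1 <= C & forall K (A : {set 'I_M}),
    decays_off_graph s C (baker K A chi).
Proof.
move=> M_gt0 /gevrey_c01_expsum_decay[c [C [C_ge1 supp chiC decay]]].
have MR_ge1 : 1 <= M%:R :> R by rewrite ler1n.
have MR_gt0 : 0 < M%:R :> R by rewrite ltr0n.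
exists (C * M%:R * C) => [|K A j l n]; first by rewrite !mulr_ege1.
have K_gt0 : (0 < K)%N by case: K j {l} => // -[].
set t : R := `|_|; pose chi_l := chi ((offset K_gt0 l)%:R / K%:R).
pose S := normc (expsum K chi (graph_angle R K_gt0 j l)) / K%:R.
have t0 : 0 <= t by exact: normr_ge0.
apply: (@le_trans _ _ (`|chi_l| * S * t ^+ n)).
  by rewrite ler_wpM2r ?exprn_ge0 // normc_baker_le.
have [chi0|chi_neq0] := eqVneq chi_l 0.
  by rewrite chi0 normr0 !mul0r !mulr_ge0 ?exprn_ge0 ?powR_ge0 ?mulr_ge0 //; lra.
have angle_c := normr_graph_angle_le M_gt0 j (supp _ chi_neq0).
have -> : t = M%:R * (K%:R * `|graph_angle R K_gt0 j l|).
  by rewrite normr_graph_angle // mulrC divfK // gt_eqF.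
have S_ge0 : 0 <= S by rewrite divr_ge0 ?normc_ge0.
have C_ge0 : 0 <= C by exact: le_trans C_ge1.
have chi_le : 0 <= `|chi_l| <= C by rewrite normr_ge0 chiC.
by apply: gevrey_decay_scale (decay _ _ K_gt0 angle_c) n.
Qed.

(** * Powers and logarithms *)

Lemma fact_leq_expn n : (n`! <= n ^ n)%N.
Proof.
elim: n => [//|n IH]; rewrite factS expnS leq_mul2l /=.
by case: n IH => // n IH; rewrite (leq_trans IH) // leq_exp2r.
Qed.

Lemma factSS_leq p : (p.+2`! <= 16 * (4 * p.+2) ^ p)%N.
Proof.
apply: leq_trans (fact_leq_expn _) _.
have -> : (16 * (4 * p.+2) ^ p = p.+2 ^ p * (2 ^ p.+2) ^ 2)%N.
  by rewrite expnMn expnAC !(expnS (2 ^ 2)); ring.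
rewrite -[X in (p.+2 ^ X)%N]addn2 expnD leq_mul2l leq_exp2r //.
by rewrite (ltnW (ltn_expl _ _)) ?orbT.
Qed.

Lemma powR_ge1 (R : realType) (x r : R) : 1 <= x -> 0 <= r -> 1 <= powR x r.
Proof. by move=> x1 r0; rewrite -(powRr0 x) ler_powR. Qed.

Lemma powR_exprn (R : realType) (x r : R) n : 0 <= x -> powR (x ^+ n) r = powR x r ^+ n.
Proof. by move=> x0; rewrite -[RHS]powR_mulrn ?powR_ge0 // powRAC powR_mulrn. Qed.

Lemma powR_div (R : realType) (x y r : R) : 0 <= x -> 0 <= y ->
  powR (x / y) r = powR x r * powR y (- r).
Proof.
move=> x0 y0; rewrite powRM ?invr_ge0 // powRN -[y^-1]powR_inv1 //.
by rewrite powRAC powR_inv1 ?powR_ge0.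
Qed.

Lemma powR_mul_powR_le (R : realType) (a x r theta : R) : 1 <= a -> theta <= 1 ->
  powR (a * powR x r) theta <= a * powR x (theta * r).
Proof.
move=> a1 theta1; rewrite powRM ?powR_ge0 ?(le_trans ler01) // -powRrM (mulrC r).
by rewrite ler_wpM2r ?powR_ge0 // ler1_powR.
Qed.

Lemma exists_log_floor (R : realType) (M : nat) (y : R) : (1 < M)%N -> 1 <= y ->
  exists k, M%:R ^+ k <= y < M%:R ^+ k.+1.
Proof.
move=> M_gt1 y1; have y0 : 0 <= y by exact: le_trans y1.
exists (trunc_log M (Num.truncn y)); rewrite -!natrX -truncn_ge_nat // -truncn_lt_nat //.
by apply: trunc_log_bounds; rewrite // truncn_gt0.
Qed.

Lemma expr_dominates_powR (R : realType) (Q B q : R) : 1 <= Q -> 1 <= B -> 1 < q ->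
  exists2 D, 0 <= D & forall nu, 1 <= nu ->
    exists p, [/\ (0 < p)%N, p%:R <= D * nu & Q * powR B nu <= q ^+ p].
Proof.
move=> Q1 B1 q1; have lnq0 : 0 < ln q by rewrite ln_gt0.
have q0 : 0 < q by exact: lt_trans q1.
have powR_log x : 1 <= x -> x = powR q (ln x / ln q).
  by move=> x1; rewrite /powR gt_eqF // divfK ?gt_eqF // lnK // posrE (lt_le_trans ltr01).
have logQ0 : 0 <= ln Q / ln q by rewrite divr_ge0 ?ln_ge0 // ltW.
have logB0 : 0 <= ln B / ln q by rewrite divr_ge0 ?ln_ge0 // ltW.
exists (ln Q / ln q + ln B / ln q + 1) => [|nu nu1]; first by rewrite !addr_ge0.
pose x := ln Q / ln q + ln B / ln q * nu.
have x0 : 0 <= x by rewrite addr_ge0 // (mulr_ge0 logB0) // (le_trans ler01).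
have /andP[p_le p_gt] := truncn_itv x0; exists (Num.truncn x).+1; split=> //.
  rewrite -natr1 (@le_trans _ _ (x + 1)) ?lerD2r // /x !mulrDl mul1r.
  by rewrite lerD // lerD // ler_peMr.
rewrite -(powR_mulrn _ (ltW q0)) (powR_log Q) // (powR_log B) // -powRrM.
by rewrite -powRD ?(gt_eqF q0) ?implybT // ler_powR ?ltW.
Qed.

(** * Distance to the Cantor set *)

Lemma card_ord_itv (R : realType) n (u v : R) : 0 <= v - u + 1 ->
  (#|[set l : 'I_n | u <= l%:R <= v]|)%:R <= v - u + 1.
Proof.
move=> uv0; set S := [set _ | _]%SET.
have [S0|/set0Pn[x0 x0S]] := eqVneq S finset.set0; first by rewrite S0 cards0.
have [lo loS lo_min] : exists2 lo, lo \in S & forall i, i \in S -> (lo <= i)%N.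
  by case: (arg_minnP (fun i : 'I_n => i : nat) x0S) => lo; exists lo.
have [hi hiS hi_max] : exists2 hi, hi \in S & forall i, i \in S -> (i <= hi)%N.
  by case: (arg_maxnP (fun i : 'I_n => i : nat) x0S) => hi; exists hi.
have card_le : (#|S| <= (hi - lo).+1)%N.
  rewrite cardE -(size_map val) -(size_iota lo (hi - lo).+1).
  apply: uniq_leq_size; first by rewrite map_inj_uniq ?enum_uniq //; exact: val_inj.
  move=> x; case/seq.mapP => i; rewrite mem_enum => iS ->.
  by rewrite mem_iota addnS ltnS subnKC ?lo_min ?hi_max.
apply: (@le_trans _ _ (hi - lo).+1%:R); first by rewrite ler_nat.
move: (loS) hiS; rewrite !inE => /andP[u_lo _] /andP[_ hi_v].
by rewrite -natr1 lerD2r natrB ?hi_max //; lra.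
Qed.

Section CantorDistance.
Variables (R : realType) (M : nat) (A : {set 'I_M}) (a0 : 'I_M).
Hypotheses (M_gt0 : (0 < M)%N) (a0A : a0 \in A).
Implicit Types (x y : R) (k : nat) (a b : 'I_M).

(* [cdist k] is the distance to the [k]-th stage of the Cantor set of numbers
   in [0, 1] all of whose base-[M] digits lie in [A]. *)
Fixpoint cdist k x : R :=
  if k is k'.+1 then
    cdist k' (M%:R * x -
      ([arg min_(a < a0 in A) (cdist k' (M%:R * x - a%:R))]%O : nat)%:R) / M%:R
  else Num.max 0 (Num.max (- x) (x - 1)).

Let MR_gt0 : 0 < M%:R :> R. Proof. by rewrite ltr0n. Qed.

Lemma cdistS k x : exists2 a, a \in A &
  cdist k.+1 x = cdist k (M%:R * x - a%:R) / M%:R /\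
  forall b, b \in A -> cdist k.+1 x <= cdist k (M%:R * x - b%:R) / M%:R.
Proof.
rewrite /=; case: arg_minP => // a aA amin; exists a => //; split => // b bA.
by rewrite ler_pM2r ?invr_gt0 // amin.
Qed.

Lemma cdist0_le x y : (cdist 0 x <= y) = [&& 0 <= y, - x <= y & x - 1 <= y].
Proof. by rewrite /= !ge_max. Qed.

Lemma cdist0_ge x : [/\ 0 <= cdist 0 x, - x <= cdist 0 x & x - 1 <= cdist 0 x].
Proof. by apply/and3P; rewrite -cdist0_le. Qed.

Lemma cdist_ge0 k x : 0 <= cdist k x.
Proof.
elim: k x => [|k IH] x; first by rewrite /= le_max lexx.
by have [a _ [-> _]] := cdistS k x; rewrite divr_ge0 // ltW.
Qed.

Lemma cdist_leS k x : cdist k x <= cdist k.+1 x.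
Proof.
elim: k x => [|k IH] x.
  have [a _ [-> _]] := cdistS 0 x; have [ge0 left right] := cdist0_ge (M%:R * x - a%:R).
  have aM : a%:R + 1 <= M%:R :> R by rewrite natr1 ler_nat ltn_ord.
  have a_ge0 : 0 <= a%:R :> R by [].
  by rewrite cdist0_le !ler_pdivlMr //; apply/and3P; split; lra.
have [a aA [-> _]] := cdistS k.+1 x; have [_ _ [_ /(_ _ aA)]] := cdistS k x.
by move/le_trans; apply; rewrite ler_pM2r ?invr_gt0.
Qed.

Lemma cdist_expand k x a : a \in A -> M%:R * cdist k x <= cdist k (M%:R * x - a%:R).
Proof.
move=> aA; rewrite mulrC -ler_pdivlMr //; apply: le_trans (cdist_leS k x) _.
by have [_ _ [_ /(_ _ aA)]] := cdistS k x.
Qed.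

Lemma cdist_lipschitz k x y : cdist k x <= cdist k y + `|x - y|.
Proof.
elim: k x y => [|k IH] x y.
  have [ge0 left right] := cdist0_ge y.
  have xy := ler_norm (x - y); have yx := ler_norm (y - x); rewrite distrC in yx.
  by rewrite cdist0_le; apply/and3P; split; lra.
have [a aA [-> _]] := cdistS k y; have [_ _ [_ /(_ _ aA)]] := cdistS k x.
move/le_trans; apply; rewrite ler_pdivrMr // mulrDl divfK ?gt_eqF //.
apply: le_trans (IH _ (M%:R * y - a%:R)) _; rewrite lerD2l.
have -> : M%:R * x - a%:R - (M%:R * y - a%:R) = (x - y) * M%:R by ring.
by rewrite normrM (gtr0_norm MR_gt0).
Qed.

Lemma card_cdist_le k n (h x eps : R) : 0 < h -> 0 <= eps ->
  (#|[set l : 'I_n | cdist k (l%:R * h - x) <= eps]|)%:R <=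
    #|A|%:R ^+ k * ((M%:R ^+ k * h)^-1 + 2 * eps / h + 1).
Proof.
elim: k h x eps => [|k IH] h x eps h0 eps0.
  have widthE : (x + 1 + eps) / h - (x - eps) / h + 1 = h^-1 + 2 * eps / h + 1.
    by field; rewrite gt_eqF.
  rewrite !expr0 !mul1r -widthE; apply: le_trans (@card_ord_itv R n _ _ _); last first.
    by rewrite widthE !addr_ge0 ?divr_ge0 ?invr_ge0 ?mulr_ge0 // ltW.
  rewrite ler_nat; apply/subset_leq_card/fintype.subsetP => l; rewrite !inE cdist0_le.
  rewrite ler_pdivrMr // ler_pdivlMr // => /and3P[_ left right].
  by apply/andP; split; lra.
pose S a := [set l : 'I_n |
  cdist k (l%:R * (M%:R * h) - (M%:R * x + a%:R)) <= M%:R * eps]%SET.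
have cover_S : [set l : 'I_n | cdist k.+1 (l%:R * h - x) <= eps]%SET \subset
    (\bigcup_(a in A) S a)%SET.
  apply/fintype.subsetP => l; rewrite inE.
  have [a aA [-> _]] := cdistS k (l%:R * h - x).
  rewrite ler_pdivrMr // [eps * _]mulrC => la; apply/bigcupP; exists a => //.
  rewrite inE; have -> // : l%:R * (M%:R * h) - (M%:R * x + a%:R) =
    M%:R * (l%:R * h - x) - a%:R by ring.
apply: (@le_trans _ _ (\sum_(a in A) #|S a|)%:R).
  rewrite ler_nat (leq_trans (subset_leq_card cover_S)) //.
  elim/big_ind2: _ => [|B1 n1 B2 n2 le1 le2|//]; first by rewrite cards0.
  by rewrite (leq_trans (leq_card_setU _ _)) // leq_add.
have card_S a : #|S a|%:R <=
    #|A|%:R ^+ k * ((M%:R ^+ k.+1 * h)^-1 + 2 * eps / h + 1) :> R.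
  apply: le_trans (IH _ _ _ _ _) _; rewrite ?mulr_gt0 ?mulr_ge0 ?(ltW MR_gt0) //.
  by rewrite mulrA -exprSr [2 * _]mulrCA -mulf_div divff ?mul1r // gt_eqF.
rewrite natr_sum (le_trans (ler_sum _ (fun a _ => card_S a))) //.
by rewrite sumr_const -[leLHS]mulr_natl mulrA -exprS.
Qed.

Definition scaled_cdist k (lam x : R) : R := lam * cdist k (x / lam).

Lemma scaled_cdist_ge0 k lam x : 0 <= lam -> 0 <= scaled_cdist k lam x.
Proof. by move=> lam0; rewrite mulr_ge0 ?cdist_ge0. Qed.

Lemma scaled_cdist_expand k lam x y a : 0 < lam -> a \in A ->
  M%:R * scaled_cdist k lam x <=
    scaled_cdist k lam y + `|y - (M%:R * x - a%:R * lam)|.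
Proof.
move=> lam0 aA; rewrite /scaled_cdist mulrCA.
have := le_trans (cdist_expand k (x / lam) aA) (cdist_lipschitz k _ (y / lam)).
rewrite -(ler_pM2l lam0) => /le_trans; apply; rewrite mulrDr lerD2l.
have -> : M%:R * (x / lam) - a%:R - y / lam = (M%:R * x - a%:R * lam - y) / lam.
  by field; rewrite gt_eqF.
by rewrite normrM normfV (gtr0_norm lam0) distrC mulrC divfK // gt_eqF.
Qed.

End CantorDistance.

Section CantorDimension.
Variables (R : realType) (M : nat) (A : {set 'I_M}) (a0 : 'I_M).
Hypotheses (M_gt1 : (2 <= M)%N) (a0A : a0 \in A).

Definition cantor_dim : R := ln #|A|%:R / ln M%:R.

Let MR_gt0 : 0 < M%:R :> R. Proof. by rewrite ltr0n ltnW. Qed.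

Let lnM_gt0 : 0 < ln (M%:R : R). Proof. by rewrite ln_gt0 // ltr1n. Qed.

Let cardA_gt0 : (0 < #|A|)%N. Proof. by apply/card_gt0P; exists a0. Qed.

Lemma cantor_dim_ge0 : 0 <= cantor_dim.
Proof. by rewrite /cantor_dim divr_ge0 ?ln_ge0 ?ler1n // ltnW. Qed.

Lemma cantor_dim_le1 : cantor_dim <= 1.
Proof.
rewrite /cantor_dim ler_pdivrMr // mul1r ler_ln ?posrE ?ltr0n ?(ltnW M_gt1) // ler_nat.
by rewrite (leq_trans (max_card _)) // card_ord.
Qed.

Lemma powR_cantor_dim : powR M%:R cantor_dim = #|A|%:R.
Proof. by rewrite /powR gt_eqF // divfK ?gt_eqF // lnK // posrE ltr0n. Qed.

Lemma expr_card_le_powR k (y : R) : M%:R ^+ k <= y -> #|A|%:R ^+ k <= powR y cantor_dim.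
Proof.
move=> Mk_y; have Mk0 : 0 <= M%:R ^+ k :> R by rewrite exprn_ge0.
rewrite -powR_cantor_dim -powR_exprn ?(ltW MR_gt0) //.
by rewrite ge0_ler_powR ?cantor_dim_ge0 ?nnegrE ?(le_trans Mk0).
Qed.

Lemma card_near_cantor_coarse N (W : R) k : 0 < W -> N%:R <= W ->
  #|[set l : 'I_N | scaled_cdist A a0 k N%:R l%:R <= W]|%:R <=
    powR N%:R cantor_dim * powR W (1 - cantor_dim).
Proof.
move=> W_gt0 NW; apply: (@le_trans _ _ N%:R).
  by rewrite ler_nat (leq_trans (max_card _)) // card_ord.
have [->|N_gt0] := posnP N; first by rewrite mulr_ge0 ?powR_ge0.
have NE : N%:R = powR N%:R cantor_dim * powR N%:R (1 - cantor_dim) :> R.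
  rewrite -powRD ?pnatr_eq0 -?lt0n ?N_gt0 ?implybT //.
  by rewrite addrC subrK powRr1.
rewrite [leLHS]NE ler_wpM2l ?powR_ge0 //.
by rewrite ge0_ler_powR ?nnegrE ?subr_ge0 ?cantor_dim_le1 ?(ltW W_gt0).
Qed.

Lemma card_near_cantor_fine N (W : R) k : (0 < N)%N -> 1 <= W ->
  M%:R ^+ k <= N%:R / W < M%:R ^+ k.+1 ->
  #|[set l : 'I_N | scaled_cdist A a0 k N%:R l%:R <= W]|%:R <=
    (M%:R + 3) * powR N%:R cantor_dim * powR W (1 - cantor_dim).
Proof.
move=> N_gt0 W_ge1 /andP[k_le k_lt]; have W_gt0 : 0 < W by exact: lt_le_trans W_ge1.
have NR_gt0 : 0 < N%:R :> R by rewrite ltr0n.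
have Mk0 : 0 < M%:R ^+ k :> R by rewrite exprn_gt0.
have -> : [set l : 'I_N | scaled_cdist A a0 k N%:R l%:R <= W]%SET =
    [set l : 'I_N | cdist A a0 k (l%:R * N%:R^-1 - 0) <= W / N%:R]%SET.
  by apply/setP => l; rewrite !inE subr0 ler_pdivlMr // mulrC.
have eps0 : 0 <= W / N%:R by rewrite divr_ge0 ?ltW.
have step0 : 0 < N%:R^-1 :> R by rewrite invr_gt0.
apply: le_trans (card_cdist_le (ltnW M_gt1) a0A k N 0 step0 eps0) _.
have -> : (M%:R ^+ k / N%:R)^-1 + 2 * (W / N%:R) / N%:R^-1 + 1 =
    N%:R / M%:R ^+ k + 2 * W + 1 by field; rewrite !gt_eqF.
have width_le : N%:R / M%:R ^+ k <= M%:R * W.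
  by rewrite ler_pdivrMr // mulrAC -exprS -ler_pdivrMr // ltW.
have stages_le : #|A|%:R ^+ k <= powR N%:R cantor_dim * powR W (- cantor_dim).
  by rewrite -powR_div ?(ltW W_gt0) //; exact: expr_card_le_powR.
have -> : powR W (1 - cantor_dim) = powR W (- cantor_dim) * W.
  by rewrite addrC powRD ?powRr1 ?(ltW W_gt0) // (gt_eqF W_gt0) implybT.
have -> : (M%:R + 3) * powR N%:R cantor_dim * (powR W (- cantor_dim) * W) =
    powR N%:R cantor_dim * powR W (- cantor_dim) * ((M%:R + 3) * W) by ring.
have width0 : 0 <= N%:R / M%:R ^+ k :> R by rewrite divr_ge0 ?(ltW NR_gt0) ?(ltW Mk0).
by rewrite ler_pM ?exprn_ge0 //; lra.
Qed.

Lemma card_near_cantor N (W : R) : (0 < N)%N -> 1 <= W ->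
  exists k, #|[set l : 'I_N | scaled_cdist A a0 k N%:R l%:R <= W]|%:R <=
    (M%:R + 3) * powR N%:R cantor_dim * powR W (1 - cantor_dim).
Proof.
move=> N_gt0 W_ge1; have W_gt0 : 0 < W by exact: lt_le_trans W_ge1.
have [NW|WN] := leP N%:R W.
  exists 0; apply: le_trans (card_near_cantor_coarse 0 W_gt0 NW) _.
  by rewrite -mulrA ler_peMl ?mulr_ge0 ?powR_ge0 //; have := MR_gt0; lra.
have [k k_log] : exists k, M%:R ^+ k <= N%:R / W < M%:R ^+ k.+1.
  by apply: exists_log_floor; rewrite // ler_pdivlMr // mul1r ltW.
by exists k; exact: card_near_cantor_fine.
Qed.

End CantorDimension.

(** * Weighted columns with Gevrey decay *)

Section InverseSquareSum.
Variable R : realType.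
Implicit Type x : R.

Definition saturation x : R := x / (1 + `|x|).

Lemma saturationN x : saturation (- x) = - saturation x.
Proof. by rewrite /saturation normrN mulNr. Qed.

Lemma norm_saturation_le1 x : `|saturation x| <= 1.
Proof.
have x1 : 0 < 1 + `|x| by rewrite ltr_wpDr.
by rewrite normrM normfV (gtr0_norm x1) ler_pdivrMr // mul1r lerDr.
Qed.

Lemma inv_sqr_le_saturation_diff x : (0 <= x) || (x <= -1) ->
  ((1 + `|x|) ^+ 2)^-1 <= 2 * (saturation (x + 1) - saturation x).
Proof.
have nonneg y : 0 <= y -> ((1 + y) ^+ 2)^-1 <= 2 * (saturation (y + 1) - saturation y).
  move=> y0; rewrite /saturation !ger0_norm ?addr_ge0 //.
  have -> : 2 * ((y + 1) / (1 + (y + 1)) - y / (1 + y)) = 2 / ((1 + y) * (2 + y)).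
    by field; rewrite !gt_eqF //; lra.
  rewrite -[leLHS]mul1r ler_pdivrMr ?exprn_gt0 //; last lra.
  by rewrite mulrAC ler_pdivlMr ?mulr_gt0 //; nra.
case/orP=> [x0|x1]; first by rewrite {1}ger0_norm // nonneg.
have /nonneg : 0 <= - (x + 1) by lra.
have -> : - (x + 1) + 1 = - x by ring.
rewrite !saturationN opprK [- saturation x + _]addrC; apply: le_trans.
by rewrite ler0_norm ?lef_pV2 ?posrE ?exprn_gt0 ?lerXn2r ?nnegrE //; lra.
Qed.

Lemma sum_inv_sqr_dist_le n (c : nat) :
  \sum_(j < n) ((1 + `|j%:R - c%:R|) ^+ 2)^-1 <= 4 :> R.
Proof.
pose F (j : nat) := saturation (j%:R - c%:R).
apply: (@le_trans _ _ (\sum_(j < n) 2 * (F j.+1 - F j))).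
  apply: ler_sum => j _; have -> : F j.+1 = saturation (j%:R - c%:R + 1).
    by rewrite /F -natr1 addrAC.
  apply: inv_sqr_le_saturation_diff; have [cj|jc] := leqP c j.
    by rewrite subr_ge0 ler_nat cj.
  by apply/orP; right; rewrite lerBlDr addrC -lerBlDr opprK natr1 ler_nat.
rewrite -mulr_sumr -(big_mkord xpredT (fun j => F j.+1 - F j)) telescope_sumr //.
have := norm_saturation_le1 (n%:R - c%:R); have := norm_saturation_le1 (0%:R - c%:R).
by rewrite !ler_norml => /andP[? ?] /andP[? ?]; rewrite /F; lra.
Qed.

End InverseSquareSum.

Section WeightedColumns.
Variables (R : realType) (s C : R) (p : nat).
Hypotheses (s_ge0 : 0 <= s) (C_ge1 : 1 <= C).

Definition weight_scale (x : R) : R := 18 * C * powR (4 * (x + 2)) s.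

Definition colsum_cst : R := 64 * C ^+ 3 * powR 16 s.

Lemma colsum_cst_ge1 : 1 <= colsum_cst.
Proof.
have P1 : 1 <= powR (16 : R) s by rewrite powR_ge1 //; lra.
by rewrite /colsum_cst !mulr_ege1 //; lra.
Qed.

Lemma powR_factSS_le :
  powR (p.+2`!%:R : R) s <= powR 16 s * powR (4 * (p%:R + 2)) s ^+ p.
Proof.
rewrite -natrD addn2 -powR_exprn -?powRM ?exprn_ge0 //.
rewrite ge0_ler_powR ?nnegrE ?mulr_ge0 ?exprn_ge0 //.
by rewrite -natrM -natrX -natrM ler_nat factSS_leq.
Qed.

Lemma weight_scale_ge18 x : 0 <= x -> 18 <= weight_scale x.
Proof.
move=> x0; rewrite /weight_scale -mulrA ler_peMr // mulr_ege1 // powR_ge1 //; lra.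
Qed.

Lemma weight_scale_dilate x y nu : 0 <= x -> 0 <= y -> 1 <= nu -> x <= y * nu ->
  weight_scale x <= weight_scale y * powR nu s.
Proof.
move=> x0 y0 nu1 xy; have C_ge0 : 0 <= 18 * C by rewrite mulr_ge0 // (le_trans ler01).
have y_nu0 : 0 <= y * nu by rewrite mulr_ge0 //; lra.
rewrite /weight_scale -[leRHS]mulrA ler_wpM2l // -powRM; try lra.
by rewrite ge0_ler_powR ?nnegrE //; lra.
Qed.

Lemma weight_ge18 W : weight_scale p%:R <= W -> 18 <= W.
Proof. by apply: le_trans; exact: weight_scale_ge18. Qed.

Section Decay.
Variables W b t : R.
Hypotheses (W_ge : weight_scale p%:R <= W) (b_ge0 : 0 <= b) (t_ge0 : 0 <= t).
Hypothesis decay : gevrey_decay s C b t.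

Let C_ge0 := le_trans ler01 C_ge1.

Lemma decay_times_weight_near : 8 * t <= W ->
  b * (1 + t / W) ^+ p * (1 + t) ^+ 2 <= 16 * C ^+ 3 * powR 16 s * (9 / 8) ^+ p.
Proof.
move=> tW; have C_C3 : C <= C ^+ 3 by rewrite ler_eXnr.
have P1 : 1 <= powR (16 : R) s by rewrite powR_ge1 //; lra.
have C3_C3P : C ^+ 3 <= C ^+ 3 * powR 16 s by rewrite ler_peMr ?exprn_ge0.
have b_le : b <= C by have := decay 0; rewrite mulr1 expr1 fact0 powR1 mulr1 mul1r.
have bt2_le : b * t ^+ 2 <= 3 * (C ^+ 3 * powR 16 s).
  apply: le_trans (decay 2) _; rewrite -mulrA !ler_wpM2l ?exprn_ge0 //.
  by rewrite ge0_ler_powR ?nnegrE // ler_nat.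
have bt_le : b * (1 + t) ^+ 2 <= 16 * C ^+ 3 * powR 16 s.
  have sqr_le : b * (1 + t) ^+ 2 <= 2 * b + 2 * (b * t ^+ 2).
    by have : 0 <= b * (1 - t) ^+ 2; [rewrite mulr_ge0 ?sqr_ge0|nra].
  have CP0 : 0 <= C ^+ 3 * powR 16 s by rewrite mulr_ge0 ?exprn_ge0 ?powR_ge0.
  by rewrite -mulrA; lra.
have W_ge18 := weight_ge18 W_ge.
have weight_le : (1 + t / W) ^+ p <= (9 / 8) ^+ p.
  have tW0 : 0 <= t / W by rewrite divr_ge0 //; lra.
  rewrite lerXn2r ?nnegrE ?addr_ge0 //; try lra.
  suff : t / W <= 1 / 8 by lra.
  by rewrite ler_pdivrMr; lra.
rewrite mulrAC ler_pM ?mulr_ge0 ?exprn_ge0 ?addr_ge0 ?divr_ge0 //; lra.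
Qed.

Lemma decay_times_weight_far : W < 8 * t ->
  b * (1 + t / W) ^+ p * (1 + t) ^+ 2 <= 16 * C ^+ 3 * powR 16 s.
Proof.
move=> Wt; have W_ge18 := weight_ge18 W_ge; have W_gt0 : 0 < W by lra.
have tW0 : 0 <= t / W by rewrite divr_ge0 //; lra.
have weight_le : (1 + t / W) ^+ p <= (9 / W) ^+ p * t ^+ p.
  rewrite -exprMn lerXn2r ?nnegrE ?addr_ge0 ?mulr_ge0 ?invr_ge0 ?(ltW W_gt0) //.
  by rewrite mulrAC ler_pdivlMr // mulrDl divfK ?gt_eqF //; lra.
have sqr_le : (1 + t) ^+ 2 <= 4 * t ^+ 2 by nra.
apply: (@le_trans _ _ (b * ((9 / W) ^+ p * t ^+ p) * (4 * t ^+ 2))).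
  by rewrite ler_pM ?mulr_ge0 ?exprn_ge0 ?addr_ge0 // ler_wpM2l.
have -> : b * ((9 / W) ^+ p * t ^+ p) * (4 * t ^+ 2) = 4 * (9 / W) ^+ p * (b * t ^+ p.+2).
  by rewrite -(addn2 p) exprD; ring.
set Y := powR (4 * (p%:R + 2)) s; have Y0 : 0 <= Y by exact: powR_ge0.
have fact_le : p.+3%:R * C ^+ p.+3 * powR (p.+2`!%:R) s <=
    4 * 2 ^+ p * (C ^+ 3 * C ^+ p) * (powR 16 s * Y ^+ p).
  rewrite ler_pM ?powR_ge0 ?powR_factSS_le //; first by rewrite mulr_ge0 ?exprn_ge0.
  rewrite -exprD ler_wpM2r ?exprn_ge0 //.
  have -> : 4 * 2 ^+ p = (2 ^ p.+2)%:R :> R by rewrite natrX !exprS; ring.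
  by rewrite ler_nat ltn_expl.
have coef0 : 0 <= 4 * (9 / W) ^+ p by rewrite mulr_ge0 ?exprn_ge0 ?divr_ge0 ?(ltW W_gt0).
apply: le_trans (ler_wpM2l coef0 (le_trans (decay _) fact_le)) _.
have -> : 4 * (9 / W) ^+ p * (4 * 2 ^+ p * (C ^+ 3 * C ^+ p) * (powR 16 s * Y ^+ p)) =
    16 * C ^+ 3 * powR 16 s * (18 * C * Y / W) ^+ p.
  have -> : 18 * C * Y / W = 9 / W * 2 * C * Y by ring.
  by rewrite !(exprMn p); ring.
rewrite ler_piMr ?mulr_ge0 ?exprn_ge0 ?powR_ge0 //.
rewrite exprn_ile1 ?divr_ge0 ?mulr_ge0 ?(ltW W_gt0) //.
by rewrite ler_pdivrMr // mul1r.
Qed.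

(* For [8 * t <= W] the decay of order 2 suffices; beyond, the decay of order
   [p + 2] absorbs the weight, because [W] is a large multiple of [p ^ s]. *)
Lemma decay_times_weight :
  b * (1 + t / W) ^+ p * (1 + t) ^+ 2 <= 16 * C ^+ 3 * powR 16 s * (9 / 8) ^+ p.
Proof.
have [|/decay_times_weight_far] := leP (8 * t) W; first exact: decay_times_weight_near.
move/le_trans; apply; rewrite ler_peMr ?mulr_ge0 ?exprn_ge0 ?powR_ge0 //.
by rewrite exprn_ege1 //; lra.
Qed.

End Decay.

Lemma invr_weight_shift (W d D t : R) : 0 < W -> 0 <= d -> 0 <= D -> 0 <= t ->
  D <= d + t -> (W + d)^-1 <= (1 + t / W) / (W + D).
Proof.
move=> W_gt0 d_ge0 D0 t_ge0 Ddt; have tW0 : 0 <= t / W by rewrite divr_ge0 // ltW.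
rewrite -[leLHS]mul1r ler_pdivrMr; last lra.
rewrite mulrAC ler_pdivlMr; last lra.
have -> : (1 + t / W) * (W + d) = W + d + t + t / W * d by field; rewrite gt_eqF.
by have := mulr_ge0 tW0 d_ge0; lra.
Qed.

Lemma weighted_colsum_gevrey_le n (B : 'M[R]_n) (d : 'I_n -> R) (mu W : R) (l : 'I_n)
    (c : nat) :
  weight_scale p%:R <= W -> 0 <= mu -> (forall j, 0 <= d j) -> (forall j, 0 <= B j l) ->
  (forall j, gevrey_decay s C (B j l) `|j%:R - c%:R|) ->
  (forall j, mu * d l <= d j + `|j%:R - c%:R|) ->
  weighted_colsum (fun j => (W + d j) ^- p) B l <=
    colsum_cst * (9 / 8 * ((W + d l) / (W + mu * d l))) ^+ p.
Proof.
move=> W_ge mu_ge0 d_ge0 B_ge0 decay expand.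
have W_ge18 := weight_ge18 W_ge.
have W_gt0 : 0 < W by lra.
have D0 : 0 <= mu * d l by rewrite mulr_ge0.
pose Q := 16 * C ^+ 3 * powR 16 s * (9 / 8) ^+ p / (W + mu * d l) ^+ p.
have term j : B j l * (W + d j) ^- p <= Q * ((1 + `|j%:R - c%:R|) ^+ 2)^-1.
  set t := `|_|; have t_ge0 : 0 <= t by exact: normr_ge0.
  have WD0 : 0 < (W + mu * d l) ^+ p by rewrite exprn_gt0 //; lra.
  rewrite ler_pdivlMr ?exprn_gt0 //; last lra.
  rewrite /Q ler_pdivlMr //.
  apply: le_trans (decay_times_weight W_ge (B_ge0 j) t_ge0 (decay j)).
  rewrite mulrAC ler_wpM2r ?sqr_ge0 // -mulrA ler_wpM2l //.
  rewrite -ler_pdivlMr // -expr_div_n -exprVn.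
  have dj0 := d_ge0 j; have inv0 : 0 <= (W + d j)^-1 by rewrite invr_ge0; lra.
  rewrite lerXn2r ?nnegrE ?(le_trans inv0) //; exact: invr_weight_shift (expand j).
have Q0 : 0 <= Q.
  by rewrite !mulr_ge0 ?invr_ge0 ?exprn_ge0 ?powR_ge0 //; have := C_ge1; lra.
have dl0 := d_ge0 l; have Wdl : 0 < (W + d l) ^+ p by rewrite exprn_gt0 //; lra.
rewrite /weighted_colsum ler_pdivrMr ?invr_gt0 //.
apply: le_trans (ler_sum _ (fun j _ => term j)) _; rewrite -mulr_sumr.
have -> : colsum_cst * (9 / 8 * ((W + d l) / (W + mu * d l))) ^+ p * (W + d l) ^- p =
    Q * 4.
  rewrite exprMn (expr_div_n (W + d l)) /Q /colsum_cst; field.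
  by rewrite !gt_eqF ?exprn_gt0 //; lra.
exact: ler_wpM2l (sum_inv_sqr_dist_le R n c).
Qed.

End WeightedColumns.

(** * Counting the eigenvalues of the baker's map *)

Section BakerCount.
Variables (R : realType) (M K p k : nat) (s C W : R) (A : {set 'I_M}) (a0 : 'I_M).
Variable chi : R -> R.
Hypotheses (M_gt1 : (2 <= M)%N) (K_gt0 : (0 < K)%N) (a0A : a0 \in A).
Hypotheses (s_ge0 : 0 <= s) (C_ge1 : 1 <= C) (W_ge : weight_scale s C p%:R <= W).
Hypothesis decay : decays_off_graph s C (baker K A chi).

Definition site_dist (l : 'I_(K * M)) : R := scaled_cdist A a0 k (K * M)%:R l%:R.

Definition site_weight (l : 'I_(K * M)) : R := (W + site_dist l) ^- p.

Lemma site_dist_ge0 l : 0 <= site_dist l.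
Proof. by rewrite scaled_cdist_ge0 // ltnW. Qed.

Lemma site_dist_expand j l : branch K_gt0 l \in A ->
  M%:R * site_dist l <= site_dist j + `|j%:R - (l %% K * M)%:R|.
Proof.
move=> lA; have KM_gt0 : 0 < (K * M)%:R :> R by rewrite ltr0n muln_gt0 K_gt0 ltnW.
apply: le_trans (scaled_cdist_expand (ltnW M_gt1) a0A k l%:R j%:R KM_gt0 lA) _.
have -> // : M%:R * l%:R - (branch K_gt0 l)%:R * (K * M)%:R = (l %% K * M)%:R :> R.
by rewrite /= [in X in X - _](divn_eq l K) natrD !natrM; ring.
Qed.

Lemma baker_weighted_colsum_le l :
  weighted_colsum site_weight (absmx (baker K A chi)) l <=
    colsum_cst s C * (9 / 8 * ((W + site_dist l) / (W + M%:R * site_dist l))) ^+ p.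
Proof.
have W_ge18 := weight_ge18 s_ge0 C_ge1 W_ge.
have d0 := site_dist_ge0 l; have Md0 : 0 <= M%:R * site_dist l by rewrite mulr_ge0.
have [lA|lA] := boolP (branch K_gt0 l \in A).
  apply: (weighted_colsum_gevrey_le s_ge0 C_ge1 (c := (l %% K * M)%N)) => // j.
  - exact: site_dist_ge0.
  - by rewrite mxE normc_ge0.
  - by rewrite mxE; exact: decay.
  - exact: site_dist_expand.
rewrite /weighted_colsum big1 ?mul0r => [|j _]; last first.
  by rewrite mxE bakerE (negPf lA) !mul0r normc0 mul0r.
rewrite mulr_ge0 ?exprn_ge0 ?(le_trans ler01 (colsum_cst_ge1 s_ge0 C_ge1)) //.
by rewrite mulr_ge0 // divr_ge0 //; lra.
Qed.

(* Beyond distance [W] the expansion gains a factor [2 / 3] against the loss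
   [9 / 8] of [decay_times_weight], and [9 / 8 * (2 / 3) <= (9 / 8) ^- 2]. *)
Lemma eig_count_baker_le (t : R) :
  (0 < p)%N -> 0 < t -> colsum_cst s C <= t * (9 / 8) ^+ p ->
  (eig_count (baker K A chi) t <= 3 * #|[set l | (site_dist l <= W)%R]|)%N.
Proof.
move=> p_gt0 t_gt0 Qt; have W_ge18 := weight_ge18 s_ge0 C_ge1 W_ge.
have Q_ge0 := le_trans ler01 (colsum_cst_ge1 s_ge0 C_ge1).
set q : R := (9 / 8) ^+ p in Qt.
have q1 : 1 < q by rewrite exprn_egt1 -?lt0n //; lra.
have weight_gt0 l : 0 < site_weight l.
  by rewrite invr_gt0 exprn_gt0 //; have := site_dist_ge0 l; lra.
have ratio_le l r : 0 <= r -> W + site_dist l <= r * (W + M%:R * site_dist l) ->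
    weighted_colsum site_weight (absmx (baker K A chi)) l <=
    t * q * (9 / 8 * r) ^+ p.
  move=> r0 Wr; apply: le_trans (baker_weighted_colsum_le l) _.
  have d0 := site_dist_ge0 l; have Md0 : 0 <= M%:R * site_dist l by rewrite mulr_ge0.
  set ratio := _ / (W + _); have ratio0 : 0 <= ratio by rewrite divr_ge0 //; lra.
  have ratio_r : ratio <= r by rewrite ler_pdivrMr //; lra.
  have loss0 : 0 <= 9 / 8 :> R by lra.
  have base0 := mulr_ge0 loss0 ratio0; have base_le := ler_wpM2l loss0 ratio_r.
  by rewrite ler_pM ?exprn_ge0 // lerXn2r ?nnegrE // (le_trans base0).
apply: (eig_count_le_card (k := 2) (q := q) weight_gt0 t_gt0 q1) => l.
  have d0 := site_dist_ge0 l.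
  have := ratio_le l 1; rewrite mulr1 mul1r -/q -mulrA -expr2; apply=> //.
  by rewrite lerD2l ler_peMl // ler1n ltnW.
rewrite inE -ltNge => Wd; have Md : 2 * site_dist l <= M%:R * site_dist l.
  by rewrite ler_wpM2r ?site_dist_ge0 // ler_nat.
have {}Wd : W < site_dist l by exact: Wd.
apply: le_trans (ratio_le l (2 / 3) _ _) _; [lra|lra|].
rewrite -mulrA ler_wpM2l ?(ltW t_gt0) // -[q^-1]mul1r ler_pdivlMr ?(lt_trans ltr01) //.
rewrite /q -!exprMn exprn_ile1 //; lra.
Qed.

End BakerCount.

Lemma eig_count_baker_powR_le (R : realType) (M K p : nat) (s C W t : R)
    (A : {set 'I_M}) (chi : R -> R) :
  (2 <= M)%N -> (0 < K)%N -> A != finset.set0 -> 0 <= s -> 1 <= C ->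
  decays_off_graph s C (baker K A chi) ->
  weight_scale s C p%:R <= W -> (0 < p)%N -> 0 < t ->
  colsum_cst s C <= t * (9 / 8) ^+ p ->
  (eig_count (baker K A chi) t)%:R <= 3 * (M%:R + 3) *
    powR (K * M)%:R (cantor_dim R A) * powR W (1 - cantor_dim R A).
Proof.
move=> M_gt1 K_gt0 /set0Pn[a0 a0A] s_ge0 C_ge1 decay W_ge p_gt0 t_gt0 Qt.
have KM_gt0 : (0 < K * M)%N by rewrite muln_gt0 K_gt0 ltnW.
have W_ge1 : 1 <= W by have := weight_ge18 s_ge0 C_ge1 W_ge; lra.
have [k card_le] := card_near_cantor M_gt1 a0A KM_gt0 W_ge1.
have := eig_count_baker_le k M_gt1 K_gt0 a0A s_ge0 C_ge1 W_ge decay p_gt0 t_gt0 Qt.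
rewrite -(ler_nat R) natrM => /le_trans; apply.
by rewrite -!mulrA ler_wpM2l // mulrA.
Qed.

Theorem theorem2 (R : realType) (M : nat) (s : R) (chi : R -> R) :
  (2 <= M)%N -> 1 < s -> gevrey_c01 s chi ->
  (forall x : R, 0 <= chi x <= 1) ->
  exists C : R, forall A : {set 'I_M}, A != finset.set0 ->
    let delta := ln (#|A|%:R : R) / ln (M%:R : R) in
    exists N0 : nat, forall (nu : R) (K : nat), 1 <= nu -> (N0 <= K * M)%N ->
      ((counting_fn K A chi nu)%:R : R)
        <= C * powR ((K * M)%:R) delta * powR nu ((1 - delta) * s).
Proof.
move=> M_gt1 s1 gevrey_chi _; have s_ge0 : 0 <= s by lra.
have M_ge1 : 1 <= M%:R :> R by rewrite ler1n ltnW.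
have [C C_ge1 decay] := baker_decays_off_graph (ltnW M_gt1) gevrey_chi.
have q1 : 1 < 9 / 8 :> R by lra.
have [D D_ge0 exponent] := expr_dominates_powR (colsum_cst_ge1 s_ge0 C_ge1) M_ge1 q1.
pose W0 := weight_scale s C D; exists (3 * (M%:R + 3) * W0) => A A_neq0 delta.
exists 1%N => nu K nu1; rewrite muln_gt0 => /andP[K_gt0 _].
have [p [p_gt0 p_le Qp]] := exponent nu nu1.
have W_ge : weight_scale s C p%:R <= W0 * powR nu s by exact: weight_scale_dilate.
have t_gt0 : 0 < powR M%:R (- nu) :> R by rewrite powR_gt0 // (lt_le_trans ltr01).
have Qt : colsum_cst s C <= powR M%:R (- nu) * (9 / 8) ^+ p.
  by rewrite powRN ler_pdivlMl 1?mulrC // powR_gt0 // (lt_le_trans ltr01).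
have [a0 a0A] := set0Pn _ A_neq0.
have := eig_count_baker_powR_le M_gt1 K_gt0 A_neq0 s_ge0 C_ge1 (decay K A) W_ge p_gt0.
move=> /(_ _ t_gt0 Qt) /le_trans; apply.
rewrite [_ * W0 * _]mulrAC -[leRHS]mulrA ler_wpM2l ?mulr_ge0 ?powR_ge0 ?addr_ge0 //.
rewrite powR_mul_powR_le //; last by rewrite gerBl (cantor_dim_ge0 R M_gt1 a0A).
by have := weight_scale_ge18 s_ge0 C_ge1 D_ge0; rewrite -/W0; lra.
Qed.
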